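(* Let $A=(a_{ij})\in\mathbb{R}^{n\times n}$ be a primitive matrix with Perron root $\rho(A)$. Then there exist positive real numbers $x_1,\dots,x_n$ such that the positive rank one matrix $X=(x_j/x_i)_{i,j=1}^n$, i.e. $$X=\begin{pmatrix}1 & x_2/x_1 & \cdots & x_n/x_1\\ x_1/x_2 & 1 & \cdots & x_n/x_2\\ \vdots & \vdots & \ddots & \vdots\\ x_1/x_n & x_2/x_n & \cdots & 1\end{pmatrix},$$ has the following property: the matrix $B=A\circ X$ is similar to $A$, and all row sums of $B$ are the same and equal to $\rho(A)$, that is, $\sum_{j=1}^n b_{ij}=\rho(A)$ for every $i=1,\dots,n$. Likewise for column sums: there exist positive real numbers $x_1,\dots,x_n$ (not necessarily the same as those above) such that, with $X=(x_j/x_i)_{i,j=1}^n$, the matrix $B=A\circ X$ is similar to $A$ and $\sum_{i=1}^n b_{ij}=\rho(A)$ for every $j=1,\dots,n$.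
   Context: A real matrix is positive (nonnegative) if all its entries are $>0$ ($\geq 0$). A nonnegative square matrix $A$ is primitive if $A^m$ is a positive matrix for some integer $m\geq 1$. The Perron root $\rho(A)$ of a primitive matrix $A$ is its spectral radius, which is a simple eigenvalue of $A$. The symbol $\circ$ denotes the Hadamard (entrywise) product: $A\circ X=(a_{ij}x_{ij})$. *)

(* Defs.v *)
From HB Require Import structures.
From mathcomp Require Import all_boot all_order all_algebra.
From mathcomp Require Import complex.
From mathcomp Require Import boolp classical_sets reals.

Set Implicit Arguments.
Unset Strict Implicit.
Unset Printing Implicit Defensive.

Import Order.TTheory GRing.Theory Num.Theory.

Local Open Scope classical_set_scope.
Local Open Scope ring_scope.

Definition positive_mx (R : realType) (m n : nat) (A : 'M[R]_(m, n)) : Prop :=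
  forall i j, 0 < A i j.

Definition nonnegative_mx (R : realType) (m n : nat) (A : 'M[R]_(m, n)) : Prop :=
  forall i j, 0 <= A i j.

Definition primitive_mx (R : realType) (n : nat) (A : 'M[R]_n) : Prop :=
  nonnegative_mx A /\ exists2 m : nat, (1 <= m)%N & positive_mx (A ^+ m).

(* The eigenvalues are those of A viewed as a complex matrix. For n > 0 the set
   of their moduli is finite and nonempty, so that the supremum is a maximum. *)
Definition spectral_radius (R : realType) (n : nat) (A : 'M[R]_n) : R :=
  sup [set Normc.normc z |
        z in [set z : R[i] | eigenvalue (map_mx (real_complex R) A) z]].

Definition hadamard (R : realType) (m n : nat) (A X : 'M[R]_(m, n)) :
  'M[R]_(m, n) := map2_mx *%R A X.

Definition ratio_mx (R : realType) (n : nat) (x : 'I_n -> R) : 'M[R]_n :=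
  \matrix_(i, j) (x j / x i).

(* Main.v *)
(** The Collatz-Wielandt argument.  Among the nonnegative row vectors v of sum 1
    choose one for which v A >= t v holds with t maximal, which exists by
    compactness.  If v A <> t v, then a positive power A^m turns the nonzero
    nonnegative vector v A - t v into a positive one, so that v A^m satisfies
    the inequality with a larger t; hence v A = t v, and v A^m = t^m v is
    positive.  A positive left eigenvector of eigenvalue t pairs with the
    moduli of the entries of any complex right eigenvector to bound every
    eigenvalue by t, so t is the spectral radius.  The rescaling x is a
    positive eigenvector of A on the right for the row sums, and the entrywise
    inverse of one on the left for the column sums. *)
Require Import Defs.
From HB Require Import structures.
From mathcomp Require Import all_boot all_order all_algebra.
From mathcomp Require Import complex.
From mathcomp Require Import boolp classical_sets reals.
From mathcomp Require Import topology normedtype derive.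

Import Order.TTheory GRing.Theory Num.Theory.
Import numFieldNormedType.Exports.

Local Open Scope classical_set_scope.
Local Open Scope ring_scope.

(** * Eigenvalue bounds and the spectral radius from a positive left eigenvector *)

Section Spectrum.
Variable R : realType.

Lemma eigenvalue_tr (F : fieldType) n (A : 'M[F]_n) a :
  eigenvalue A^T a = eigenvalue A a.
Proof.
rewrite !eigenvalue_root_char; congr root.
rewrite /char_poly -[RHS]det_tr; congr (\det _).
by apply/matrixP => i j; rewrite !mxE eq_sym.
Qed.

Lemma nonnegative_tr m n (A : 'M[R]_(m, n)) :
  nonnegative_mx A -> nonnegative_mx A^T.
Proof. by move=> A_ge0 i j; rewrite mxE. Qed.

Lemma trmx_exp n (A : 'M[R]_n) m : A^T ^+ m = (A ^+ m)^T.
Proof.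
elim: m => [|m IH]; first by rewrite !expr0 trmx1.
by rewrite exprS exprSr IH trmx_mul.
Qed.

Lemma primitive_tr n (A : 'M[R]_n) : primitive_mx A -> primitive_mx A^T.
Proof.
move=> [A_ge0 [m m_gt0 Am_gt0]]; split; first exact: nonnegative_tr.
by exists m => // i j; rewrite trmx_exp mxE.
Qed.

Lemma ler_normc_sum (I : Type) (s : seq I) (F : I -> R[i]) :
  Normc.normc (\sum_(i <- s) F i) <= \sum_(i <- s) Normc.normc (F i).
Proof.
elim/big_ind2: _ => [|x a y b ha hb|//]; first by rewrite Normc.normc0.
exact: (le_trans (le_normcD _ _) (lerD ha hb)).
Qed.

Lemma normc_ge0 (z : R[i]) : 0 <= Normc.normc z.
Proof. by case: z => a b; apply: sqrtr_ge0. Qed.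

Lemma normc_real (a : R) : 0 <= a -> Normc.normc (real_complex R a) = a.
Proof. by move=> a_ge0; rewrite /= expr0n addr0 sqrtr_sqr ger0_norm. Qed.

Lemma sum_row_gt0 n (v w : 'rV[R]_n) :
  positive_mx v -> nonnegative_mx w -> w != 0 -> 0 < \sum_j v 0 j * w 0 j.
Proof.
move=> v_gt0 w_ge0 w_neq0.
have s_ge0 j : true -> 0 <= v 0 j * w 0 j.
  by move=> _; rewrite mulr_ge0// ltW.
rewrite lt_neqAle sumr_ge0// andbT eq_sym; apply: contra w_neq0 => /eqP s0.
apply/eqP/rowP => j; rewrite mxE.
have /eqP : v 0 j * w 0 j = 0 by exact: (psumr_eq0P s_ge0 s0).
by rewrite mulf_eq0 gt_eqF//= => /eqP.
Qed.

Lemma eigenvalue_le_positive n (A : 'M[R]_n) (v : 'rV[R]_n) (r : R) (z : R[i]) :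
  nonnegative_mx A -> positive_mx v -> v *m A = r *: v ->
  eigenvalue (map_mx (real_complex R) A) z -> Normc.normc z <= r.
Proof.
move=> A_ge0 v_gt0 vA.
(* [eigenvalue] refers to row eigenvectors, so passing to the transpose makes [w] a right
   eigenvector of [A], which can be paired with [v]. *)
rewrite -eigenvalue_tr => /eigenvalueP[w wA w_neq0].
pose a : 'rV[R]_n := \row_j Normc.normc (w 0 j).
have a_ge0 : nonnegative_mx a by move=> i j; rewrite mxE normc_ge0.
have a_neq0 : a != 0.
  apply: contra w_neq0 => /eqP /rowP a0; apply/eqP/rowP => j.
  by have := a0 j; rewrite !mxE => /Normc.eq0_normc.
have za i : Normc.normc z * a 0 i <= \sum_j A i j * a 0 j.
  have /rowP/(_ i) := wA; rewrite !mxE => e.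
  rewrite -Normc.normcM -e; apply: (le_trans (ler_normc_sum _ _ _)).
  apply: ler_sum => j _.
  by rewrite !mxE Normc.normcM normc_real// mulrC.
(* The pairing of [v] with [a] is positive, so both sides may be multiplied by it; moving [A] onto
   [v] then turns the right side into the pairing of [v] with [A a]. *)
rewrite -(ler_pM2r (sum_row_gt0 _ _ _ v_gt0 a_ge0 a_neq0)).
have -> : r * \sum_j v 0 j * a 0 j = \sum_i v 0 i * \sum_j A i j * a 0 j.
  under [RHS]eq_bigr => i _ do rewrite mulr_sumr.
  rewrite exchange_big/= mulr_sumr; apply: eq_bigr => j _.
  have /rowP/(_ j) := vA; rewrite !mxE => e.
  rewrite mulrA -e mulr_suml; by apply: eq_bigr => i _; rewrite mulrA.
rewrite mulr_sumr; apply: ler_sum => i _.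
by rewrite mulrCA ler_wpM2l// ltW.
Qed.

Lemma eigenvalue_positive n (A : 'M[R]_n) (v : 'rV[R]_n) (r : R) :
  (0 < n)%N -> nonnegative_mx A -> positive_mx v -> v *m A = r *: v ->
  eigenvalue A r /\ 0 <= r.
Proof.
case: n A v => // n A v _ A_ge0 v_gt0 vA; split.
  apply/eigenvalueP; exists v => //.
  by apply/eqP => /rowP/(_ 0) v0; have := v_gt0 0 0; rewrite v0 mxE ltxx.
have /rowP/(_ 0) := vA; rewrite !mxE => e.
rewrite -(pmulr_lge0 _ (v_gt0 0 0)) -e.
by apply: sumr_ge0 => i _; rewrite mulr_ge0// ltW.
Qed.

(** The modulus of [r] itself lies in the set, so the upper bound is attained and equals the
    supremum. *)
Lemma spectral_radius_eq n (A : 'M[R]_n) (r : R) :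
  0 <= r -> eigenvalue A r ->
  (forall z, eigenvalue (map_mx (real_complex R) A) z -> Normc.normc z <= r) ->
  spectral_radius A = r.
Proof.
move=> r_ge0 rA zA; rewrite /spectral_radius; set S := image _ _.
have Sr : S r.
  by exists (real_complex R r); [rewrite /= eigenvalue_map | exact: normc_real].
have ubS : ubound S r by move=> _ [z /= /zA zr <-].
apply/le_anti/andP; split; first by apply: ge_sup => //; exists r.
by apply: ub_le_sup => //; exists r.
Qed.

Lemma spectral_radius_positive n (A : 'M[R]_n) (v : 'rV[R]_n) (r : R) :
  (0 < n)%N -> nonnegative_mx A -> positive_mx v -> v *m A = r *: v ->
  spectral_radius A = r.
Proof.
move=> n_gt0 A_ge0 v_gt0 vA.
have [rA r_ge0] := eigenvalue_positive _ _ _ _ n_gt0 A_ge0 v_gt0 vA.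
by apply: spectral_radius_eq => // z; exact: eigenvalue_le_positive vA.
Qed.

(** Serves the row sums, where only a positive right eigenvector is at hand; the bound carries over
    because transposition preserves the spectrum. *)
Lemma spectral_radius_tr_positive n (A : 'M[R]_n) (v : 'rV[R]_n) (r : R) :
  (0 < n)%N -> nonnegative_mx A -> positive_mx v -> v *m A = r *: v ->
  spectral_radius A^T = r.
Proof.
move=> n_gt0 A_ge0 v_gt0 vA.
have [rA r_ge0] := eigenvalue_positive _ _ _ _ n_gt0 A_ge0 v_gt0 vA.
apply: spectral_radius_eq; rewrite ?eigenvalue_tr// => z.
have -> : map_mx (real_complex R) A^T = (map_mx (real_complex R) A)^T.
  by rewrite map_trmx.
by rewrite eigenvalue_tr; exact: eigenvalue_le_positive vA.
Qed.

End Spectrum.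

(** * Existence of a positive left eigenvector *)

Section Perron.
Variables (R : realType) (n : nat) (A : 'M[R]_n.+1).

Let simplex : set 'rV[R]_n.+1 :=
  [set v | (forall j, 0 <= v 0 j <= 1) /\ \sum_j v 0 j = 1].

Let superharmonic (v : 'rV[R]_n.+1) (t : R) :=
  forall j, t * v 0 j <= (v *m A) 0 j.

Lemma simplexZ (v : 'rV[R]_n.+1) : nonnegative_mx v -> v != 0 ->
  simplex ((\sum_j v 0 j)^-1 *: v).
Proof.
move=> v_ge0 v_neq0.
have s_gt0 : 0 < \sum_j v 0 j.
  have := @sum_row_gt0 R _ (const_mx 1) v.
  under eq_bigr => j _ do rewrite mxE mul1r.
  by apply => // i j; rewrite mxE.
split.
  move=> j; rewrite mxE mulr_ge0 ?invr_ge0 ?(ltW s_gt0)//=.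
  rewrite mulrC ler_pdivrMr// mul1r (bigD1 j)//= lerDl.
  exact: sumr_ge0.
under eq_bigr => j _ do rewrite mxE.
by rewrite -mulr_sumr mulVf// gt_eqF.
Qed.

(** Maximizing over pairs [(v, t)] makes the objective the continuous second projection and leaves
    only the compactness of the set of admissible pairs to prove. *)
Lemma superharmonic_max : nonnegative_mx A ->
  exists2 vt : 'rV[R]_n.+1 * R, simplex vt.1 /\ superharmonic vt.1 vt.2 &
    forall v t, simplex v -> superharmonic v t -> t <= vt.2.
Proof.
move=> A_ge0.
(* Summing [t * v 0 j <= (v *m A) 0 j] over [j] bounds [t] by [M], as [v] has sum 1 and entries at
   most 1. *)
pose M : R := \sum_j \sum_i A i j.
pose box : set ('rV[R]_n.+1 * R) :=
  [set v : 'rV[R]_n.+1 | forall j, `[0, 1]%classic (v 0 j)] `*` `[0, M]%classic.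
pose K : set ('rV[R]_n.+1 * R) :=
  box `&` ([set p : 'rV[R]_n.+1 * R | \sum_j p.1 0 j = 1] `&`
    \bigcap_(j in [set: 'I_n.+1])
      [set p : 'rV[R]_n.+1 * R | 0 <= (p.1 *m A) 0 j - p.2 * p.1 0 j]).
have KP p : K p <-> [/\ simplex p.1, 0 <= p.2 & superharmonic p.1 p.2].
  split.
    move=> [[/= p01 p0] [/= p1 pA]]; split.
    - by split => // j; have := p01 j; rewrite /= in_itv.
    - by move: p0; rewrite in_itv/= => /andP[].
    - by move=> j; rewrite -subr_ge0; exact: (pA j I).
  move=> [[p01 p1] p0 pA]; split; split => //=.
  - rewrite in_itv/= p0/= -[p.2]mulr1 -p1 mulr_sumr ler_sum// => j _.
    apply: le_trans (pA j) _; rewrite mxE ler_sum// => i _.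
    by rewrite -[leRHS]mul1r ler_wpM2r//; case/andP: (p01 i).
  - by move=> j _; rewrite /= subr_ge0; exact: pA.
have c1 j : continuous (fun p : 'rV[R]_n.+1 * R => p.1 0 j).
  move=> p; apply: (@continuous_comp _ _ _ fst (fun v : 'rV[R]_n.+1 => v 0 j)).
    exact: cvg_fst.
  exact: coord_continuous.
have cA j : continuous (fun p : 'rV[R]_n.+1 * R => (p.1 *m A) 0 j).
  have -> : (fun p : 'rV[R]_n.+1 * R => (p.1 *m A) 0 j) =
            (fun p => \sum_i p.1 0 i * A i j) by apply/funext => p; rewrite mxE.
  apply: (continuous_big add_continuous) => i _ p.
  by apply: cvgM; [exact: c1 | exact: cvg_cst].
have cK : compact K.
  apply: compact_closedI; last first.
    apply: closedI.
      apply: (@preimage_closed _ _ (fun p : 'rV[R]_n.+1 * R => \sum_j p.1 0 j)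
        [set x | x = 1]); last first.
        exact: (@closed_eq R 1).
      by move=> p _; exact: (continuous_big add_continuous).
    apply: closed_bigI => j _.
    apply: (@preimage_closed _ _ (fun p : 'rV[R]_n.+1 * R =>
        (p.1 *m A) 0 j - p.2 * p.1 0 j) [set x | 0 <= x]);
      last exact: (@closed_ge R 0).
    move=> p _.
    by apply: cvgB; [exact: cA | apply: cvgM; [exact: cvg_snd | exact: c1]].
  apply: compact_setX; last exact: segment_compact.
  have := @rV_compact R n.+1 (fun=> `[0, 1]%classic).
  by apply=> _; exact: segment_compact.
have K0 : K !=set0.
  exists ((\sum_j (const_mx 1 : 'rV[R]_n.+1) 0 j)^-1 *: const_mx 1, 0).
  have H : simplex ((\sum_j (const_mx 1 : 'rV[R]_n.+1) 0 j)^-1 *: const_mx 1).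
    apply: simplexZ; first by move=> i j; rewrite mxE.
    by apply/eqP => /rowP/(_ 0)/eqP; rewrite !mxE oner_eq0.
  apply/KP; split => // j; rewrite mul0r mxE sumr_ge0// => i _.
  by rewrite mulr_ge0//; case: H => /(_ i)/andP[].
have csnd : {within K, continuous (snd : 'rV[R]_n.+1 * R -> R)}.
  by apply: continuous_subspaceT => q; exact: cvg_snd.
have [p /set_mem/KP[p1 p2_ge0 pA] pmax] := compact_EVT_max K0 cK csnd.
(* [K] contains only pairs with [0 <= t]; a negative [t] lies below [p.2] anyway. *)
exists p => // v t v1 vA; have [t_ge0|/ltW t_le0] := leP 0 t.
  by apply: (pmax (v, t)); apply/mem_set/KP.
exact: le_trans p2_ge0.
Qed.

Lemma mulmx_gt0 (w : 'rV[R]_n.+1) (P : 'M[R]_n.+1) :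
  nonnegative_mx w -> w != 0 -> positive_mx P -> positive_mx (w *m P).
Proof.
move=> w_ge0 w_neq0 P_gt0 i j; rewrite ord1 mxE.
have := @sum_row_gt0 R _ (\row_k P k j) w.
under eq_bigr => k _ do rewrite mxE mulrC.
by apply=> // ? k; rewrite mxE.
Qed.

Lemma perron_left_eigenvector : primitive_mx A ->
  exists v : 'rV[R]_n.+1, exists r : R, positive_mx v /\ v *m A = r *: v.
Proof.
move=> [A_ge0 [m _ Am_gt0]].
have [[v t] /= [v1 vA] tmax] := superharmonic_max A_ge0.
have v_ge0 : nonnegative_mx v.
  by move=> i j; rewrite ord1; case: v1 => /(_ j)/andP[].
have v_neq0 : v != 0.
  apply/eqP => v0; case: v1 => _; rewrite v0.
  under eq_bigr => j _ do rewrite mxE.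
  by rewrite big1// => /eqP; rewrite eq_sym oner_eq0.
pose y := v *m A ^+ m.
have y_gt0 : positive_mx y by exact: mulmx_gt0.
have Am : A ^+ m *m A = A *m A ^+ m by rewrite -[LHS]exprSr -[RHS]exprS.
have vA_eq : v *m A = t *: v.
  apply/eqP/negPn/negP; rewrite -subr_eq0 => d_neq0.
  set d := v *m A - t *: v in d_neq0.
  have d_ge0 : nonnegative_mx d.
    by move=> i j; rewrite ord1 !mxE subr_ge0; have := vA j; rewrite mxE.
  have dAm_gt0 : positive_mx (d *m A ^+ m) by exact: mulmx_gt0.
  (* Powers of [A] commute with [A], so the defect of [y] is the image under [A ^+ m] of the defect
     of [v]. *)
  have yA : y *m A - t *: y = d *m A ^+ m.
    by rewrite mulmxBl -scalemxAl -!mulmxA Am.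
  (* The least ratio [q j0] is the largest amount by which [t] can be raised while [y] keeps the
     inequality; normalizing [y] then contradicts the maximality of [t]. *)
  pose q j := (d *m A ^+ m) 0 j / y 0 j.
  pose j0 := [arg min_(j < 0%R) q j]%O.
  have q_ge j : q j0 <= q j.
    by rewrite /j0; case: arg_minP => // i _; apply.
  have q_gt0 : 0 < q j0 by rewrite divr_gt0.
  suff : t + q j0 <= t by rewrite leNgt ltrDl q_gt0.
  have y_ge0 : nonnegative_mx y by move=> i j; rewrite ltW.
  have y_neq0 : y != 0.
    by apply/eqP => /rowP/(_ 0) y0; have := y_gt0 0 0; rewrite y0 mxE ltxx.
  have s_ge0 : 0 <= (\sum_j y 0 j)^-1 by rewrite invr_ge0 sumr_ge0.
  apply: (tmax _ _ (simplexZ _ y_ge0 y_neq0)) => j.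
  rewrite -scalemxAl [X in _ * X]mxE [leRHS]mxE mulrCA ler_wpM2l//.
  rewrite mulrDl -lerBrDl.
  have -> : (y *m A) 0 j - t * y 0 j = (d *m A ^+ m) 0 j.
    by rewrite -yA !mxE.
  by rewrite -ler_pdivlMr ?q_ge.
exists v, t; split=> // i j.
have yE k : v *m A ^+ k = t ^+ k *: v.
  elim: k => [|k IH]; first by rewrite !expr0 scale1r mulmx1.
  by rewrite exprSr mulmxA IH -scalemxAl vA_eq scalerA -exprSr.
(* Since [y] equals [t ^+ m *: v], a zero entry of [v] would be a zero entry of [y]. *)
rewrite lt_neqAle v_ge0 andbT; apply/eqP => v0.
by have := y_gt0 i j; rewrite /y yE mxE -v0 mulr0 ltxx.
Qed.

End Perron.

(** * Hadamard product with a ratio matrix as diagonal conjugation *)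

Section Rescaling.
Variables (R : realType) (n : nat) (A : 'M[R]_n) (x : 'I_n -> R).
Hypotheses (n_gt0 : (0 < n)%N) (x_gt0 : forall i, 0 < x i).

Lemma ratio_mx_positive : positive_mx (ratio_mx x).
Proof. by move=> i j; rewrite mxE divr_gt0. Qed.

Lemma ratio_mx_rank : \rank (ratio_mx x) = 1%N.
Proof.
have -> : ratio_mx x = (\col_i (x i)^-1) *m (\row_j x j).
  by apply/matrixP => i j; rewrite !mxE big_ord1 !mxE mulrC.
apply/eqP; rewrite eqn_leq mulmx_max_rank lt0n mxrank_eq0/=.
apply/eqP => /matrixP/(_ (Ordinal n_gt0) (Ordinal n_gt0))/eqP.
by rewrite !mxE big_ord1 !mxE mulVf ?oner_eq0// gt_eqF.
Qed.

(** With [P] the diagonal matrix of the inverses of the [x i], both [P A] and [B P] have entries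
    [A i j / x i], where [B] is the Hadamard product. *)
Lemma hadamard_ratio_similar : similar_in unitmx A (hadamard A (ratio_mx x)).
Proof.
pose P := diag_mx (\row_i (x i)^-1).
have P_unit : P \in unitmx.
  rewrite unitmxE det_diag unitfE; apply/prodf_neq0 => i _.
  by rewrite mxE invr_eq0 gt_eqF.
exists P => //; apply/(simmxP P_unit).
rewrite mul_diag_mx mul_mx_diag; apply/matrixP => i j; rewrite !mxE.
by rewrite mulrA mulrAC mulfK ?gt_eqF// mulrC.
Qed.

End Rescaling.

Theorem theorem2p1 (R : realType) (n : nat) (A : 'M[R]_n)
  (n_gt0 : (0 < n)%N) (A_primitive : primitive_mx A) :
  (exists x : 'I_n -> R,
     let X := ratio_mx x in
     let B := hadamard A X in
     [/\ forall i, 0 < x i,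
         positive_mx X /\ \rank X = 1%N,
         similar_in unitmx A B &
         forall i, \sum_(j < n) B i j = spectral_radius A])
  /\
  (exists x : 'I_n -> R,
     let X := ratio_mx x in
     let B := hadamard A X in
     [/\ forall i, 0 < x i,
         positive_mx X /\ \rank X = 1%N,
         similar_in unitmx A B &
         forall j, \sum_(i < n) B i j = spectral_radius A]).
Proof.
case: n A n_gt0 A_primitive => // n A _ A_prim.
have [A_ge0 _] := A_prim.
split.
  (* A left eigenvector of the transpose is a right eigenvector of [A]. *)
  have [u [r [u_gt0 uA]]] := perron_left_eigenvector _ _ _ (primitive_tr _ _ _ A_prim).
  have rho : spectral_radius A = r.
    rewrite -[A]trmxK.
    exact: spectral_radius_tr_positive (nonnegative_tr _ _ _ _ A_ge0) u_gt0 uA.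
  exists (u 0) => X B; split => //.
  - by split; [exact: ratio_mx_positive | exact: ratio_mx_rank].
  - exact: hadamard_ratio_similar.
  (* Multiplied by [u 0 i], the [i]-th row sum of [B] becomes the [i]-th entry of [A u], that is
     [r * u 0 i]. *)
  move=> i; rewrite rho; apply: (mulfI (lt0r_neq0 (u_gt0 0 i))).
  have /rowP/(_ i) := uA; rewrite !mxE => e.
  rewrite [RHS]mulrC -e mulr_sumr; apply: eq_bigr => j _; rewrite !mxE.
  by rewrite mulrCA [u 0 i * _]mulrC divfK ?gt_eqF// mulrC.
have [v [r [v_gt0 vA]]] := perron_left_eigenvector _ _ _ A_prim.
have rho := spectral_radius_positive _ _ _ _ _ (ltn0Sn n) A_ge0 v_gt0 vA.
(* With this choice [B i j] is [A i j * v 0 i / v 0 j], so the [j]-th column sum times [v 0 j] is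
   the [j]-th entry of [v *m A]. *)
pose x i := (v 0 i)^-1; have x_gt0 i : 0 < x i by rewrite invr_gt0.
exists x => X B; split => //.
- by split; [exact: ratio_mx_positive | exact: ratio_mx_rank].
- exact: hadamard_ratio_similar.
move=> j; rewrite rho; apply: (mulIf (lt0r_neq0 (v_gt0 0 j))).
have /rowP/(_ j) := vA; rewrite !mxE => <-; rewrite mulr_suml.
apply: eq_bigr => i _; rewrite !mxE /x invrK mulrA mulrAC.
by rewrite divfK ?gt_eqF// mulrC.
Qed.
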